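(* Let $X\in SO^{+}(2,1)$ be symmetric. Then $X$ is either positive definite or indefinite. If $X$ is positive definite, then $X=\Phi_{2,1}(\pm Y)$ for some $Y\in SL(2,\mathbf{R})$ which is also (symmetric) positive definite. If $X$ is indefinite, then $X$ is diagonal and $X=\Phi_{2,1}(\pm Y)$ for some antisymmetric $Y\in SL(2,\mathbf{R})$.
   Context: $I_{2,1}=\mathrm{diag}(1,1,-1)$; $SO(2,1)=\{X\in M(3,\mathbf{R}): X^TI_{2,1}X=I_{2,1},\ \det X=1\}$ and $SO^{+}(2,1)$ is its identity component. The map $\Phi_{2,1}:SL(2,\mathbf{R})\to SO^{+}(2,1)$ is the double covering (a surjective group homomorphism with kernel $\{\pm I\}$) which sends $\begin{pmatrix} y_1 & y_2 \\ y_3 & y_4 \end{pmatrix}$ to $$\begin{pmatrix} 1+2y_2y_3 & y_2y_4-y_1y_3 & -(y_1y_3+y_2y_4) \\ y_3y_4-y_1y_2 & \tfrac12(y_1^2-y_2^2-y_3^2+y_4^2) & \tfrac12(y_1^2+y_2^2-y_3^2-y_4^2) \\ -(y_1y_2+y_3y_4) & \tfrac12(y_1^2-y_2^2+y_3^2-y_4^2) & \tfrac12(y_1^2+y_2^2+y_3^2+y_4^2) \end{pmatrix}.$$ *)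

(* Defs.v *)
From HB Require Import structures.
From mathcomp Require Import all_boot all_order all_algebra sesquilinear.
From mathcomp Require Import all_classical all_reals all_analysis.

Set Implicit Arguments.
Unset Strict Implicit.
Unset Printing Implicit Defensive.

Import Order.TTheory GRing.Theory Num.Theory.
Import numFieldNormedType.Exports.

Local Open Scope classical_set_scope.
Local Open Scope ring_scope.

Definition mx_of_rows (R : nmodType) (m n : nat) (s : seq (seq R)) :
    'M[R]_(m, n) :=
  \matrix_(i, j) nth 0 (nth [::] s i) j.

Definition quadmx (R : pzRingType) (n : nat) (A : 'M[R]_n) (v : 'cV[R]_n) : R :=
  (v^T *m A *m v) 0 0.

Definition posdefmx (R : numFieldType) (n : nat) (A : 'M[R]_n) : Prop :=
  A \is symmetricmx /\ forall v : 'cV[R]_n, v != 0 -> 0 < quadmx A v.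

Definition indefmx (R : numFieldType) (n : nat) (A : 'M[R]_n) : Prop :=
  [/\ A \is symmetricmx,
      exists v : 'cV[R]_n, 0 < quadmx A v &
      exists w : 'cV[R]_n, quadmx A w < 0].

Definition I21 (R : pzRingType) : 'M[R]_3 :=
  diag_mx (\row_(j < 3) [:: 1; 1; -1]`_j).

Definition SL2 (R : comPzRingType) : set 'M[R]_2 := [set Y | \det Y = 1].
Arguments SL2 : clear implicits.

Definition SO21 (R : comPzRingType) : set 'M[R]_3 :=
  [set X | X^T *m I21 R *m X = I21 R /\ \det X = 1].
Arguments SO21 : clear implicits.

(* The topology is the entrywise one on 'M[R]_3. *)
Definition SO21_0 (R : realType) : set 'M[R]_3 :=
  connected_component (SO21 R) 1%:M.
Arguments SO21_0 : clear implicits.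

(* The same formula is used on all of 'M[R]_2; only its restriction to SL2 R
   is the double covering of SO21_0 R. *)
Definition Phi21 (R : fieldType) (Y : 'M[R]_2) : 'M[R]_3 :=
  let y1 := Y 0 0 in let y2 := Y 0 1 in
  let y3 := Y 1 0 in let y4 := Y 1 1 in
  mx_of_rows 3 3
    [:: [:: 1 + 2 * y2 * y3;
            y2 * y4 - y1 * y3;
            - (y1 * y3 + y2 * y4)];
        [:: y3 * y4 - y1 * y2;
            2^-1 * (y1 ^+ 2 - y2 ^+ 2 - y3 ^+ 2 + y4 ^+ 2);
            2^-1 * (y1 ^+ 2 + y2 ^+ 2 - y3 ^+ 2 - y4 ^+ 2)];
        [:: - (y1 * y2 + y3 * y4);
            2^-1 * (y1 ^+ 2 - y2 ^+ 2 + y3 ^+ 2 - y4 ^+ 2);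
            2^-1 * (y1 ^+ 2 + y2 ^+ 2 + y3 ^+ 2 + y4 ^+ 2)]].

(* Main.v *)
(* A matrix X in SO(2,1) satisfies X22^2 = 1 + X02^2 + X12^2 >= 1, so by
   connectedness X22 >= 1 on the identity component. Moreover adj X = J X^T J
   with J = diag(1,1,-1), so for symmetric X the 2x2 minors of X are, up to
   sign, its own entries. In particular X00 X11 = X22 + X01^2 >= 1: either
   X00 > 0 and all leading minors are positive, or X00, X11 < 0 and
   (X00 + X11)(X22 - 1) = X02^2 + X12^2 forces X = diag(-1,-1,1). *)

Require Import Defs.
From HB Require Import structures.
From mathcomp Require Import all_boot all_order all_algebra sesquilinear.
From mathcomp Require Import all_classical all_reals all_analysis.
From mathcomp Require Import ring lra.

Import Order.TTheory GRing.Theory Num.Theory.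
Import numFieldNormedType.Exports.

Local Open Scope classical_set_scope.
Local Open Scope ring_scope.

Local Notation i0 := (@Ordinal 3 0 isT).
Local Notation i1 := (@Ordinal 3 1 isT).
Local Notation i2 := (@Ordinal 3 2 isT).
Local Notation j0 := (@Ordinal 2 0 isT).
Local Notation j1 := (@Ordinal 2 1 isT).

(** Reduces every statement about symmetric [X] to six scalars, within reach of [ring], [lra] and
    [nra]. *)
Definition symmx3 {R : nmodType} (a b c d e f : R) : 'M[R]_3 :=
  mx_of_rows 3 3 [:: [:: a; b; c]; [:: b; d; e]; [:: c; e; f]].

(** * Entrywise expansions in dimensions 2 and 3 *)

Lemma sum_ord2 {V : nmodType} (F : 'I_2 -> V) : \sum_i F i = F j0 + F j1.
Proof.
rewrite 2!big_ord_recl big_ord0 addr0.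
by congr (F _ + F _); apply: val_inj.
Qed.

Lemma sum_ord3 {V : nmodType} (F : 'I_3 -> V) :
  \sum_i F i = F i0 + F i1 + F i2.
Proof.
rewrite 3!big_ord_recl big_ord0 addr0 addrA.
by congr (F _ + F _ + F _); apply: val_inj.
Qed.

Lemma det_mx22 {R : comPzRingType} (A : 'M[R]_2) :
  \det A = A j0 j0 * A j1 j1 - A j0 j1 * A j1 j0.
Proof.
rewrite (expand_det_row _ j0) sum_ord2 /cofactor !det_mx11 !mxE /= expr0 expr1.
rewrite mul1r mulN1r mulrN.
by congr (_ * A _ _ - _ * A _ _); apply: val_inj.
Qed.

(** * Entry identities in SO(2,1) and its identity component *)

(** Multiplying X^T J X = J on the right by adj X, where X adj X = 1, gives X^T J = J adj X; and J
    is its own inverse. *)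
Lemma SO21_adj {R : comPzRingType} (X : 'M[R]_3) :
  SO21 R X -> \adj X = I21 R *m X^T *m I21 R.
Proof.
move=> [XIX detX].
have I2 : I21 R *m I21 R = 1%:M.
  rewrite /I21 mulmx_diag; apply/matrixP => i j; rewrite !mxE.
  by case: i => [[|[|[|//]]] ?] /=; rewrite ?mulrNN mulr1.
rewrite -[RHS]mulmx1 -detX -(mul_mx_adj X) !mulmxA.
by rewrite -(mulmxA (I21 R)) -(mulmxA (I21 R)) XIX I2 mul1mx.
Qed.

Lemma SO21_22_sqr {R : comPzRingType} (X : 'M[R]_3) : SO21 R X ->
  X i2 i2 ^+ 2 = 1 + X i0 i2 ^+ 2 + X i1 i2 ^+ 2.
Proof.
move=> [/matrixP/(_ i2 i2) + _].
rewrite !(mxE, sum_ord3) /= !mulr1n => E.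
have -> : 1 = X i2 i2 ^+ 2 - X i0 i2 ^+ 2 - X i1 i2 ^+ 2.
  by apply: oppr_inj; rewrite -E; ring.
ring.
Qed.

Lemma symmetricmx3E {R : fieldType} (X : 'M[R]_3) : X \is symmetricmx ->
  X = symmx3 (X i0 i0) (X i0 i1) (X i0 i2) (X i1 i1) (X i1 i2) (X i2 i2).
Proof.
move=> /is_hermitianmxP; rewrite expr0 scale1r map_mx_id // => XT.
have XC i j : X i j = X j i by rewrite {1}XT mxE.
apply/matrixP => i j; rewrite !mxE.
case: i => [[|[|[|//]]] ?]; case: j => [[|[|[|//]]] ?] /=.
all: by [congr (X _ _); apply: val_inj
        | rewrite XC; congr (X _ _); apply: val_inj].
Qed.

Lemma SO21_symmx3 {R : comPzRingType} (a b c d e f : R) :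
  SO21 R (symmx3 a b c d e f) ->
  [/\ d * f - e ^+ 2 = a, a * f - c ^+ 2 = d, a * d - b ^+ 2 = f,
      c * e - b * f = b & a * e - b * c = e].
Proof.
move=> /SO21_adj /matrixP E.
(* The (1,2) entry of J X J is -e, so the last identity is read off with both sides negated. *)
split; last apply: oppr_inj.
1: move: (E i0 i0).
2: move: (E i1 i1).
3: move: (E i2 i2).
4: move: (E i0 i1).
5: move: (E i1 i2).
all: rewrite !mxE /cofactor det_mx22 !(mxE, sum_ord3) /= => H.
all: by apply: (etrans _ (etrans H _)); ring.
Qed.

Lemma quadmx_symmx3 {R : comPzRingType} (a b c d e f : R) (v : 'cV[R]_3) :
  quadmx (symmx3 a b c d e f) v =
  a * v i0 0 ^+ 2 + d * v i1 0 ^+ 2 + f * v i2 0 ^+ 2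
  + 2 * (b * v i0 0 * v i1 0 + c * v i0 0 * v i2 0 + e * v i1 0 * v i2 0).
Proof. by rewrite /quadmx !(mxE, sum_ord3) /=; ring. Qed.

Lemma SO21_0_22_ge1 {R : realType} (X : 'M[R]_3) :
  SO21_0 R X -> 1 <= X i2 i2.
Proof.
move=> X0; rewrite leNgt; apply/negP => Xlt1.
have SO1 : SO21 R 1%:M by split; rewrite ?det1// trmx1 mul1mx mulmx1.
have fcts : continuous (fun M : 'M[R]_3 => M i2 i2) by exact: coord_continuous.
have /connected_intervalP itv := connected_continuous_connected
  (@component_connected _ (SO21 R) 1%:M) (continuous_subspaceT fcts).
(* The (2,2) entries on the component form an interval containing 1. If one were below 1, its
   maximum with 0 would also be attained; it lies in [0,1), where the square cannot be at least
   1. *)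
have [Y /connected_component_sub/SO21_22_sqr Ysq Y01] :
    [set M i2 i2 | M in SO21_0 R] (Num.max (X i2 i2) 0).
  apply: (itv (X i2 i2) (1%:M i2 i2)); first by exists X.
    by exists 1%:M => //; exact: connected_component_refl.
  by rewrite mxE /= le_max lexx ge_max (ltW Xlt1) ler01.
have Y0 : 0 <= Y i2 i2 by rewrite Y01 le_max lexx orbT.
have Y1 : Y i2 i2 < 1 by rewrite Y01 gt_max Xlt1 ltr01.
have := sqr_ge0 (Y i0 i2); have := sqr_ge0 (Y i1 i2); nra.
Qed.

Lemma SO21_symmx3_sqr {R : comPzRingType} (a b c d e f : R) :
  SO21 R (symmx3 a b c d e f) -> f ^+ 2 = 1 + c ^+ 2 + e ^+ 2.
Proof. by move=> /SO21_22_sqr; rewrite !mxE. Qed.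

Lemma symmx3_symmetric {R : fieldType} (a b c d e f : R) :
  symmx3 a b c d e f \is symmetricmx.
Proof.
apply/is_hermitianmxP; rewrite expr0 scale1r map_mx_id //.
apply/matrixP => i j; rewrite !mxE.
by case: i => [[|[|[|//]]] ?]; case: j => [[|[|[|//]]] ?].
Qed.

(** * The dichotomy and positive definiteness *)

Lemma SO21_symmx3_cases {R : realFieldType} (a b c d e f : R) :
  SO21 R (symmx3 a b c d e f) -> 1 <= f ->
  0 < a \/ symmx3 a b c d e f = symmx3 (-1) 0 0 (-1) 0 1.
Proof.
move=> SOX f1; have [adj00 adj11 adj22 adj01 _] := SO21_symmx3 _ _ _ _ _ _ SOX.
have [a0|a_le0] := ltP 0 a; [by left | right].
have ad1 : 1 <= a * d by have := sqr_ge0 b; lra.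
have d_lt0 : d < 0 by nra.
have a_lt0 : a < 0 by nra.
(* Sum of [adj00] and [adj11]; the left side is nonpositive since a, d < 0 and f >= 1. *)
have E : (a + d) * (f - 1) = c ^+ 2 + e ^+ 2 by lra.
have ce0 : c ^+ 2 + e ^+ 2 <= 0 by rewrite -E; nra.
have c0 : c = 0.
  by apply/eqP; rewrite -sqrf_eq0 eq_le sqr_ge0 andbT; have := sqr_ge0 e; lra.
have e0 : e = 0.
  by apply/eqP; rewrite -sqrf_eq0 eq_le sqr_ge0 andbT; have := sqr_ge0 c; lra.
have f_eq1 : f = 1 by apply/eqP; rewrite eq_le f1 andbT; nra.
move: adj00 adj22 adj01; rewrite c0 e0 f_eq1 expr0n /= => adj00 adj22 adj01.
have b0 : b = 0 by lra.
have d_eq_a : d = a by lra.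
(* The remaining minor says a^2 = 1, and the sign of a selects -1. *)
have /eqP : (a + 1) * (a - 1) = 0 by rewrite b0 d_eq_a expr0n /= in adj22; lra.
by rewrite b0 d_eq_a mulf_eq0 => /orP[] /eqP a1; [congr symmx3; lra | exfalso; lra].
Qed.

Lemma SO21_symmx3_posdef {R : realFieldType} (a b c d e f : R) :
  SO21 R (symmx3 a b c d e f) -> 1 <= f -> 0 < a ->
  posdefmx (symmx3 a b c d e f).
Proof.
move=> SOX f1 a0; have [adj00 adj11 adj22 _ adj12] :=
  SO21_symmx3 _ _ _ _ _ _ SOX.
split=> [|v v0]; first exact: symmx3_symmetric.
have f0 : 0 < f by lra.
rewrite quadmx_symmx3.
set x := v i0 0; set y := v i1 0; set z := v i2 0; set Q := (X in 0 < X).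
(* Completing the square in x, then in y, with the minors replaced by entries of X. The three
   squares can all vanish only if z, y and x vanish in turn. *)
have E : a * f * Q = f * (a * x + b * y + c * z) ^+ 2
                     + (f * y + e * z) ^+ 2 + a * z ^+ 2.
  transitivity (f * (a * x + b * y + c * z) ^+ 2
    + f * ((a * d - b ^+ 2) * y ^+ 2 + 2 * (a * e - b * c) * y * z
           + (a * f - c ^+ 2) * z ^+ 2)); first by rewrite /Q; ring.
  by rewrite adj22 adj12 adj11 -[in a * z ^+ 2]adj00; ring.
rewrite -(pmulr_rgt0 _ (mulr_gt0 a0 f0)) E.
have [z0|z0] := eqVneq z 0; last first.
  apply: ltr_wpDl; last by rewrite pmulr_rgt0 // exprn_even_gt0.
  by rewrite addr_ge0 ?sqr_ge0 // mulr_ge0 ?sqr_ge0 // ltW.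
rewrite z0 !mulr0 !addr0 expr0n mulr0 addr0.
have [y0|y0] := eqVneq y 0; last first.
  apply: ltr_wpDl; first by rewrite mulr_ge0 ?sqr_ge0 // ltW.
  by rewrite exprn_even_gt0 //= mulf_neq0 ?(gt_eqF f0).
rewrite y0 !mulr0 !addr0 expr0n addr0 pmulr_rgt0 // exprn_even_gt0 //=.
rewrite mulf_neq0 ?(gt_eqF a0) //.
apply: contraNneq v0 => x0; apply/eqP/matrixP => i j; rewrite !mxE ord1.
case: i => [[|[|[|//]]] ?].
- by rewrite -[RHS]x0; congr (v _ _); apply: val_inj.
- by rewrite -[RHS]y0; congr (v _ _); apply: val_inj.
- by rewrite -[RHS]z0; congr (v _ _); apply: val_inj.
Qed.

(** * A positive definite preimage under [Phi21] *)

Lemma SO21_symmx3_Phi21 {R : rcfType} (a b c d e f : R) :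
  SO21 R (symmx3 a b c d e f) -> 1 <= f -> 0 < a ->
  exists Y : 'M[R]_2,
    [/\ \det Y = 1, posdefmx Y & symmx3 a b c d e f = Phi21 Y].
Proof.
move=> SOX f1 a0; have [adj00 adj11 adj22 adj01 adj12] :=
  SO21_symmx3 _ _ _ _ _ _ SOX.
have f2 := SO21_symmx3_sqr _ _ _ _ _ _ SOX.
have d0 : 0 < d by have := sqr_ge0 b; nra.
(* Both (a + d)(f - 1) and f^2 - 1 equal c^2 + e^2, so f - 1 cancels. When f = 1, instead, c = e = b
   = 0 and a = d with d^2 = 1, hence d = 1. *)
have adE : a + d = f + 1.
  have [f_eq1|f_neq1] := eqVneq f 1; last first.
    by apply: (@mulIf _ (f - 1)); rewrite ?subr_eq0 //; lra.
  rewrite f_eq1 expr1n in f2 *.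
  have c0 : c = 0.
    by apply/eqP; rewrite -sqrf_eq0 eq_le sqr_ge0 andbT; have := sqr_ge0 e; lra.
  have b0 : b = 0 by rewrite c0 f_eq1 in adj01; lra.
  have a_eq_d : a = d by rewrite c0 f_eq1 expr0n /= in adj11; lra.
  rewrite b0 a_eq_d f_eq1 expr0n /= in adj22 *.
  have /eqP : (d + 1) * (d - 1) = 0 by lra.
  by rewrite mulf_eq0 => /orP[] /eqP; lra.
(* p, q, s solve Phi21 [[p, q], [q, s]] = X: the last column of Phi21 gives
   p^2 - s^2 = 2 e and q (p + s) = - c, and (p + s)^2 = 2 f + 2 when
   p s - q^2 = 1. *)
pose t := Num.sqrt (2 * f + 2).
have t0 : 0 < t by rewrite sqrtr_gt0; lra.
have t2 : t ^+ 2 = 2 * f + 2 by rewrite sqr_sqrtr //; lra.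
pose p := (t + 2 * e / t) / 2; pose s := (t - 2 * e / t) / 2; pose q := - c / t.
(* With t^2 = 2 (f + 1) and c^2 + e^2 = f^2 - 1 the quotient becomes ((f + 1) - (f - 1)) / 2. *)
have detY : p * s - q ^+ 2 = 1.
  have -> : p * s - q ^+ 2 =
      ((t ^+ 2) ^+ 2 - 4 * (e ^+ 2 + c ^+ 2)) / (4 * t ^+ 2).
    by rewrite /p /s /q; field; lra.
  have -> : e ^+ 2 + c ^+ 2 = f ^+ 2 - 1 by lra.
  by rewrite t2; field; lra.
have psE : p + s = t by rewrite /p /s; field; lra.
(* The product p s = 1 + q^2 and the sum p + s = t are both positive. *)
have p0 : 0 < p by have := sqr_ge0 q; nra.
have aE : a = 1 + 2 * q ^+ 2.
  have -> : q ^+ 2 = c ^+ 2 / t ^+ 2 by rewrite /q; field; lra.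
  (* Follows from a f - c^2 = d after substituting d = f + 1 - a. *)
  have -> : c ^+ 2 = (a - 1) * (f + 1) by lra.
  by rewrite t2; field; lra.
have bE : b = q * (s - p).
  have -> : q * (s - p) = 2 * (c * e) / t ^+ 2 by rewrite /q /s /p; field; lra.
  have -> : c * e = b * (f + 1) by lra.
  by rewrite t2; field; lra.
have cE : c = - (q * t) by rewrite /q; field; lra.
have eE : p ^+ 2 - s ^+ 2 = 2 * e by rewrite /p /s; field; lra.
have fE : p ^+ 2 + s ^+ 2 + 2 * q ^+ 2 = 2 * f.
  have : (p + s) ^+ 2 = 2 * f + 2 by rewrite psE.
  lra.
exists (mx_of_rows 2 2 [:: [:: p; q]; [:: q; s]]); split.
- by rewrite det_mx22 !mxE /= -expr2.
- split.
    apply/is_hermitianmxP; rewrite expr0 scale1r map_mx_id //.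
    apply/matrixP => i j; rewrite !mxE.
    by case: i => [[|[|//]] ?]; case: j => [[|[|//]] ?].
  move=> v v0; rewrite /quadmx !(mxE, sum_ord2) /=.
  set x := v j0 0; set y := v j1 0; set Q := (X in 0 < X).
  rewrite -(pmulr_rgt0 _ p0).
  (* Completing the square in x leaves (p s - q^2) y^2, which is y^2. *)
  have -> : p * Q = (p * x + q * y) ^+ 2 + y ^+ 2.
    by rewrite -[y ^+ 2]mul1r -detY /Q; ring.
  have [y0|y0] := eqVneq y 0; last first.
    by apply: ltr_wpDl; rewrite ?sqr_ge0 // exprn_even_gt0.
  rewrite y0 mulr0 expr0n !addr0 exprn_even_gt0 //= mulf_neq0 ?(gt_eqF p0) //.
  apply: contraNneq v0 => x0; apply/eqP/matrixP => i j; rewrite !mxE ord1.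
  case: i => [[|[|//]] ?].
  + by rewrite -[RHS]x0; congr (v _ _); apply: val_inj.
  + by rewrite -[RHS]y0; congr (v _ _); apply: val_inj.
- apply/matrixP => i j; rewrite !mxE /=.
  case: i => [[|[|[|//]]] ?]; case: j => [[|[|[|//]]] ?] /=;
    by [lra | rewrite cE -psE; ring].
Qed.

(** Each entry of [Phi21] is even in Y, so a preimage of either sign yields both. *)
Lemma Phi21N {R : fieldType} (Y : 'M[R]_2) : Phi21 (- Y) = Phi21 Y.
Proof. by rewrite /Phi21 !mxE !(mulrN, mulNr, opprK, sqrrN). Qed.

Theorem theorem22 (R : realType) (X : 'M[R]_3) (SO_X : X \in SO21_0 R)
    (sym_X : X \is symmetricmx) :
  [/\ posdefmx X \/ indefmx X,
      posdefmx X ->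
        exists Y : 'M[R]_2,
          [/\ Y \in SL2 R, posdefmx Y, X = Phi21 Y & X = Phi21 (- Y)] &
      indefmx X ->
        is_diag_mx X /\
        exists Y : 'M[R]_2,
          [/\ Y \in SL2 R, Y \is skewmx, X = Phi21 Y & X = Phi21 (- Y)]].
Proof.
have X0 : SO21_0 R X by rewrite -in_setE.
have := connected_component_sub X0; have := SO21_0_22_ge1 X X0.
rewrite (symmetricmx3E X sym_X) mxE /=.
move: (X i0 i0) (X i0 i1) (X i0 i2) (X i1 i1) (X i1 i2) (X i2 i2).
move=> a b c d e f f1 SOX {X SO_X sym_X X0}.
(* Test vectors: on diag(-1,-1,1) the form is -1 at [e0] and 1 at [e2]. *)
pose e0 : 'cV[R]_3 := delta_mx i0 0; pose e2 : 'cV[R]_3 := delta_mx i2 0.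
have quad_e0 a' b' c' d' e' f' : quadmx (symmx3 a' b' c' d' e' f') e0 = a'.
  by rewrite quadmx_symmx3 !mxE /=; ring.
have quad_e2 a' b' c' d' e' f' : quadmx (symmx3 a' b' c' d' e' f') e2 = f'.
  by rewrite quadmx_symmx3 !mxE /=; ring.
have e0_neq0 : e0 != 0.
  by apply/eqP => /matrixP/(_ i0 0)/eqP; rewrite !mxE /= oner_eq0.
have [a0|->] := SO21_symmx3_cases _ _ _ _ _ _ SOX f1.
  have pos := SO21_symmx3_posdef _ _ _ _ _ _ SOX f1 a0.
  split; first by left.
    have [Y [detY posY ->]] := SO21_symmx3_Phi21 _ _ _ _ _ _ SOX f1 a0.
    by move=> _; exists Y; rewrite Phi21N in_setE.
  (* A negative value rules out positive definiteness, once w = 0, where the form vanishes, is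
     excluded. *)
  case=> _ _ [w w_lt0]; have [w0|w_neq0] := eqVneq w 0.
    by move: w_lt0; rewrite w0 /quadmx mulmx0 mxE ltxx.
  by have := lt_trans w_lt0 (pos.2 w w_neq0); rewrite ltxx.
split.
- right; split; first exact: symmx3_symmetric.
    by exists e2; rewrite quad_e2.
  by exists e0; rewrite quad_e0 ltrN10.
- by move=> [_ /(_ e0 e0_neq0)]; rewrite quad_e0 ltr0N1.
- move=> _; split.
    apply/is_diag_mxP => i j; rewrite mxE.
    by case: i => [[|[|[|//]]] ?]; case: j => [[|[|[|//]]] ?].
  (* Up to sign, the only antisymmetric real 2x2 matrix of determinant 1. *)
  pose Y : 'M[R]_2 := mx_of_rows 2 2 [:: [:: 0; 1]; [:: -1; 0]].
  exists Y; rewrite Phi21N.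
  suff Phi : symmx3 (-1) 0 0 (-1) 0 1 = Phi21 Y.
    split=> //.
      by rewrite in_setE /SL2 /= det_mx22 !mxE /=; ring.
    apply/is_hermitianmxP; rewrite expr1 scaleN1r map_mx_id //.
    apply/matrixP => i j; rewrite !mxE.
    by case: i => [[|[|//]] ?]; case: j => [[|[|//]] ?]; rewrite /= ?oppr0 ?opprK.
  apply/matrixP => i j; rewrite !mxE /=.
  by case: i => [[|[|[|//]]] ?]; case: j => [[|[|[|//]]] ?] /=; field.
Qed.
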